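(* Let $P$ be a simple $d$-polytope with $n$ facets which is a spindle with distinguished vertices $u$ and $v$ (every facet of $P$ contains $u$ or $v$). Let $\mathbf{c}$ be a generic cost vector such that $G(P,\mathbf{c})$ is the Hasse diagram of a poset having unique minimum $\hat 0=u$ and unique maximum $\hat 1=v$. Then $G(P,\mathbf{c})$ satisfies the face nonrevisiting property (for every face $F$, any directed path starting and ending at vertices of $F$ stays in $F$), and consequently every directed path from $u$ to $v$ in $G(P,\mathbf{c})$ has at most $n-d$ edges; in particular the distance from $u$ to $v$ in the graph of $P$ is at most $n-d$.
   Context: A polytope is simple if for each vertex $v$ and each set of $i$ edges at $v$ there is an $i$-dimensional face containing $v$ and those edges. $\mathbf{c}$ is generic if it takes distinct values on distinct vertices of $P$. $G(P,\mathbf{c})$ is the 1-skeleton of $P$ with each edge oriented from the endpoint with smaller $\mathbf{c}$-value to the one with larger $\mathbf{c}$-value. The Hasse diagram of a finite poset has a directed edge $a\to b$ iff $b$ covers $a$. A facet is a maximal proper face. *)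

(* Defs.v *)
From mathcomp Require Import all_boot all_order all_algebra.
From mathcomp Require Import boolp classical_sets functions cardinality reals.

Set Implicit Arguments.
Unset Strict Implicit.
Unset Printing Implicit Defensive.

Import Order.TTheory GRing.Theory Num.Theory.
Local Open Scope classical_set_scope.
Local Open Scope ring_scope.

Section Polytopes.
Variables (R : realType) (m : nat).
Implicit Types (P F S : set 'rV[R]_m) (c x y : 'rV[R]_m).

Definition dot (a x : 'rV[R]_m) : R := \sum_(i < m) a 0 i * x 0 i.

Definition affine_hull S : set 'rV[R]_m :=
  [set y | exists k (w : 'I_k -> R) (p : 'I_k -> 'rV[R]_m),
     [/\ forall i, S (p i), \sum_i w i = 1 & y = \sum_i w i *: p i]].

Definition convex_hull S : set 'rV[R]_m :=
  [set y | exists k (w : 'I_k -> R) (p : 'I_k -> 'rV[R]_m),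
     [/\ forall i, S (p i), forall i, 0 <= w i, \sum_i w i = 1
       & y = \sum_i w i *: p i]].

(* The affine hull of S is a translate of a k-dimensional linear subspace;
   the empty set has no dimension k : nat. *)
Definition has_dim S (k : nat) : Prop :=
  exists (x : 'rV[R]_m) (U : {vspace 'rV[R]_m}),
    \dim U = k /\ affine_hull S = [set y | y - x \in U].

Definition polytope P : Prop :=
  exists s : seq 'rV[R]_m, P = convex_hull [set` s].

(* Both set0 and P itself are faces of P (take a = 0). *)
Definition face P F : Prop :=
  exists (a : 'rV[R]_m) (b : R),
    (forall x, P x -> dot a x <= b) /\ F = P `&` [set x | dot a x = b].

Definition vertices P : set 'rV[R]_m := [set x | face P [set x]].

Definition edge P F : Prop := face P F /\ has_dim F 1.

Definition facets P : set (set 'rV[R]_m) :=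
  [set F | [/\ face P F, F <> P
    & forall G, face P G -> G <> P -> F `<=` G -> G = F]].

Definition simple_polytope P : Prop :=
  forall x, vertices P x ->
  forall (i : nat) (E : set (set 'rV[R]_m)),
    (E #= `I_i)%card -> (forall e, E e -> edge P e /\ e x) ->
    exists F, [/\ face P F, has_dim F i, F x & forall e, E e -> e `<=` F].

Definition spindle P u v : Prop :=
  [/\ vertices P u, vertices P v & forall F, facets P F -> F u \/ F v].

Definition generic P c : Prop :=
  forall x y, vertices P x -> vertices P y -> dot c x = dot c y -> x = y.

Definition adjacent P : rel 'rV[R]_m := fun x y =>
  `[< [/\ vertices P x, vertices P y, x <> y
        & exists e, [/\ edge P e, e x & e y]] >].

Definition directed_edge P c : rel 'rV[R]_m := fun x y =>
  adjacent P x y && (dot c x < dot c y).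

Definition face_nonrevisiting P c : Prop :=
  forall F, face P F ->
  forall x (p : seq 'rV[R]_m), vertices P x -> path (directed_edge P c) x p ->
    F x -> F (last x p) -> forall y, y \in x :: p -> F y.

Definition graph_distance P x y (k : nat) : Prop :=
  (exists p, [/\ path (adjacent P) x p, last x p = y & size p = k]) /\
  (forall p, path (adjacent P) x p -> last x p = y -> (k <= size p)%N).

End Polytopes.

Definition covers (disp : Order.disp_t) (T : porderType disp) (b a : T) : Prop :=
  (a < b)%O /\ forall z : T, ~~ (a < z < b)%O.

(* The graph E on the vertex set V is the Hasse diagram of T, with f identifying
   the elements of T with V. *)
Definition hasse_diagram (disp : Order.disp_t) (T : finPOrderType disp)
    (X : Type) (V : set X) (E : rel X) (f : T -> X) : Prop :=
  set_bij [set: T] V f /\ forall a b : T, E (f a) (f b) <-> covers b a.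

(* Main.v *)
(* Write E for the edges of G(P,c). Let H be a face containing u. No edge of E
   enters H: otherwise take such an edge b' -> b with c(b) minimal. As u is the
   minimum of c, some edge a -> b lies in H, and by simplicity b, a, b' lie in a
   2-face K, on which b is the maximum of c. Since K is not contained in H, some
   edge of K at a leaves H; by minimality of b it is oriented a -> a', and K
   contains a directed path from a' up to b. So a < a' < b, although b covers a.
   Dually, no edge leaves a face containing v. In a spindle this means that no
   facet is revisited, and faces are intersections of facets. Finally, each edge
   of a directed path leaves some facet for good, and at least d facets contain
   the last vertex. *)
Require Import Defs.
From mathcomp Require Import all_boot all_order all_algebra.
From mathcomp Require Import boolp classical_sets functions cardinality reals.
From mathcomp Require Import ring lra.
Set Implicit Arguments.
Unset Strict Implicit.
Unset Printing Implicit Defensive.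
Import Order.TTheory GRing.Theory Num.Theory.
Local Open Scope classical_set_scope.
Local Open Scope ring_scope.

Section ConvexGeometry.
Variables (R : realType) (m : nat).
Implicit Types (P Q F G H A : set 'rV[R]_m) (a c g x y z : 'rV[R]_m).
Implicit Types (s : seq 'rV[R]_m) (U : {vspace 'rV[R]_m}).

(** * Linear functionals as dot products *)

Lemma dotE a x : dot a x = (a *m x^T) 0 0.
Proof. by rewrite mxE; apply: eq_bigr => i _; rewrite mxE. Qed.

Lemma dotC a x : dot a x = dot x a.
Proof. by apply: eq_bigr => i _; rewrite mulrC. Qed.

Lemma dotDr a x y : dot a (x + y) = dot a x + dot a y.
Proof. by rewrite /dot -big_split; apply: eq_bigr => i _; rewrite mxE mulrDr. Qed.

Lemma dotZr a t x : dot a (t *: x) = t * dot a x.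
Proof. by rewrite /dot mulr_sumr; apply: eq_bigr => i _; rewrite mxE mulrCA. Qed.

Lemma dot0r a : dot a 0 = 0.
Proof. by rewrite -(scale0r 0) dotZr mul0r. Qed.

Lemma dotNr a x : dot a (- x) = - dot a x.
Proof. by rewrite -scaleN1r dotZr mulN1r. Qed.

Lemma dotBr a x y : dot a (x - y) = dot a x - dot a y.
Proof. by rewrite dotDr dotNr. Qed.

Lemma dotDl a c x : dot (a + c) x = dot a x + dot c x.
Proof. by rewrite dotC dotDr !(dotC x). Qed.

Lemma dotZl t a x : dot (t *: a) x = t * dot a x.
Proof. by rewrite dotC dotZr dotC. Qed.

Lemma dotNl a x : dot (- a) x = - dot a x.
Proof. by rewrite dotC dotNr dotC. Qed.

Lemma dot_sumr a k (w : 'I_k -> R) (p : 'I_k -> 'rV[R]_m) :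
  dot a (\sum_i w i *: p i) = \sum_i w i * dot a (p i).
Proof.
rewrite (big_morph _ (dotDr a) (dot0r a)).
by apply: eq_bigr => i _; rewrite dotZr.
Qed.

Lemma dot_self_gt0 x : x != 0 -> 0 < dot x x.
Proof.
move=> x0; have sq i : true -> 0 <= x 0 i * x 0 i by rewrite -expr2 sqr_ge0.
rewrite lt0r sumr_ge0 // andbT; apply: contra_neq x0 => /(psumr_eq0P sq) e.
by apply/rowP => i; rewrite mxE; apply/eqP; move/eqP: (e i isT); rewrite mulf_eq0 orbb.
Qed.

Lemma dot_adjoint (f : {linear 'rV[R]_m -> 'rV[R]_m}) g :
  exists g', forall x, dot g' x = dot g (f x).
Proof.
exists (g *m (lin1_mx f)^T) => x.
by rewrite !dotE -(mul_rV_lin1 f) trmx_mul mulmxA.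
Qed.

(** * Convex hulls and exposed points *)

Lemma hull_le A a b y :
  (forall p, A p -> dot a p <= b) -> convex_hull A y -> dot a y <= b.
Proof.
move=> leb [k [w [p [Ap w0 w1 ->]]]].
rewrite dot_sumr -[b]mul1r -w1 mulr_suml; apply: ler_sum => i _.
by apply: ler_wpM2l => //; exact: leb.
Qed.

Lemma hull_eq A a b y :
  (forall p, A p -> dot a p = b) -> convex_hull A y -> dot a y = b.
Proof.
move=> eb hy; apply/eqP; rewrite eq_le; apply/andP; split.
  by apply: hull_le hy => p /eb->.
rewrite -lerN2 -dotNl; apply: hull_le hy => p /eb.
by rewrite dotNl => ->.
Qed.

Lemma sub_hull A : A `<=` convex_hull A.
Proof.
move=> x Ax; exists 1, (fun=> 1), (fun=> x).
by split; rewrite ?big_ord1 ?scale1r.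
Qed.

Lemma hull_sub A Q : A `<=` Q -> convex_hull A `<=` convex_hull Q.
Proof. by move=> AQ y [k [w [p [Ap *]]]]; exists k, w, p; split=> // i; apply: AQ. Qed.

(** The nonnegative terms [w i * (b - dot a (p i))] sum to zero, so every point of nonzero weight is
    tight. *)
Lemma hull_support A a b y :
  (forall p, A p -> dot a p <= b) -> convex_hull A y -> dot a y = b ->
  convex_hull (A `&` [set x | dot a x = b]) y.
Proof.
move=> leb [k [w [p [Ap w0 w1 ey]]]] ay.
have ge0 i : true -> 0 <= w i * (b - dot a (p i)).
  by move=> _; rewrite mulr_ge0 // subr_ge0 leb.
have tight i : w i != 0 -> dot a (p i) = b.
  move=> wi; have /psumr_eq0P : \sum_i w i * (b - dot a (p i)) = 0.
    under eq_bigr do rewrite mulrBr.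
    by rewrite sumrB -mulr_suml w1 mul1r -dot_sumr -ey ay subrr.
  move=> /(_ ge0 i isT)/eqP.
  by rewrite mulf_eq0 (negPf wi) subr_eq0 => /eqP.
have [j wj] : exists j, w j != 0.
  apply: contrapT => n; have := w1; rewrite big1 => [/esym/eqP|i _].
    by rewrite oner_eq0.
  by apply/eqP; apply: contrapT => /negP wi; apply: n; exists i.
(* Points of weight zero need not be tight; the tight point [p j] replaces them. *)
exists k, w, (fun i => if w i == 0 then p j else p i); split=> // [i|].
  by case: eqVneq => wi; split; rewrite /= ?Ap ?tight.
by rewrite ey; apply: eq_bigr => i _; case: eqVneq => // ->; rewrite !scale0r.
Qed.

Lemma seq_argmax (T : eqType) (s : seq T) (x0 : T) (phi : T -> R) : x0 \in s ->
  exists2 q, q \in s & forall p, p \in s -> phi p <= phi q.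
Proof.
elim: s x0 => // x [|y s] IH x0 _.
  by exists x => [|p]; rewrite ?mem_head // inE => /eqP->.
have [q qs qM] := IH y (mem_head _ _).
have [le|/ltW le] := leP (phi x) (phi q).
  exists q => [|p]; first by rewrite inE qs orbT.
  by rewrite inE => /predU1P[->|/qM].
exists x => [|p]; first exact: mem_head.
by rewrite inE => /predU1P[->//|/qM] /le_trans; apply.
Qed.

(** Makes lexicographic perturbation possible: for large [M], maximizing [M *: a + a'] over a finite
    set maximizes [a] first and breaks ties by [a']. *)
Lemma large_multiplier (T : eqType) (s : seq T) (phi psi : T -> R) :
  exists M, forall p, p \in s -> 0 < phi p -> psi p < M * phi p.
Proof.
elim: s => [|x s [M HM]]; first by exists 0.
exists (Num.max M (psi x / phi x + 1)) => p.
have sup K N : K <= N -> 0 < phi p -> psi p < K * phi p -> psi p < N * phi p.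
  by move=> KN p0 /lt_le_trans; apply; rewrite ler_wpM2r // ltW.
rewrite inE => /predU1P[->|/HM{}HM] p0; last first.
  by apply: (sup M); rewrite ?HM // le_max lexx.
move: p0 => x0; apply: (@lt_le_trans _ _ ((psi x / phi x + 1) * phi x)).
  by rewrite mulrDl mulfVK ?gt_eqF // mul1r ltrDl.
by rewrite ler_wpM2r ?(ltW x0) // le_max lexx orbT.
Qed.

(* Among the maximizers of c, one of largest Euclidean norm is exposed, by
   Cauchy-Schwarz. *)
Lemma exposed_argmax s x0 c : x0 \in s ->
  exists2 q, q \in s & (forall p, p \in s -> dot c p <= dot c q) /\
    exists g, forall p, p \in s -> p != q -> dot g p < dot g q.
Proof.
move=> x0s; have [q1 q1s q1M] := seq_argmax (dot c) x0s.
have : q1 \in [seq p <- s | dot c p == dot c q1] by rewrite mem_filter eqxx.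
move=> /(seq_argmax (fun p => dot p p))[q]; rewrite mem_filter => /andP[/eqP cq qs] qM.
exists q => //; split=> [p /q1M|]; first by rewrite cq.
have [M HM] := large_multiplier s (fun p => dot c q - dot c p)
  (fun p => dot q p - dot q q).
exists (M *: c + q) => p ps pq; rewrite !dotDl !dotZl.
have [lt|] := ltP (dot c p) (dot c q).
  by have := HM _ ps; rewrite subr_gt0 => /(_ lt); lra.
rewrite cq => ge; have ep : dot c p = dot c q1 by apply/eqP; rewrite eq_le ge q1M.
rewrite ep ltrD2l; have /qM : p \in [seq p <- s | dot c p == dot c q1].
  by rewrite mem_filter ep eqxx.
(* Since [dot p p <= dot q q], positivity of the squared norm of [p - q] forces
   [dot q p < dot q q]. *)
have : p - q != 0 by rewrite subr_eq0.
move=> /dot_self_gt0; rewrite dotBr !(dotC (p - q)) !dotBr (dotC p q); lra.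
Qed.

Lemma hull_set1 x y : convex_hull [set x] y -> y = x.
Proof.
case=> k [w [p [px _ w1 ->]]]; under eq_bigr do rewrite px.
by rewrite -scaler_suml w1 scale1r.
Qed.

(** * Faces and vertices of a polytope *)

Lemma face_sub P F : face P F -> F `<=` P.
Proof. by move=> [a [b [_ ->]]] x []. Qed.

(** A face is determined by the generators it contains, so inductions on faces can count
    generators. *)
Lemma face_hull s F : face (convex_hull [set` s]) F ->
  F = convex_hull [set` [seq p <- s | `[< F p >]]].
Proof.
move=> [a [b [leb eF]]].
have les p : p \in s -> dot a p <= b by move=> ps; apply: leb; exact: sub_hull.
apply/seteqP; split=> y.
  rewrite {1}eF => -[Py ay]; have := hull_support les Py ay.
  apply: hull_sub => p [/= ps ap].
  by rewrite mem_filter ps andbT; apply/asboolP; rewrite eF; split=> //; exact: sub_hull.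
move=> hy; rewrite eF; split.
  by apply: hull_sub hy => p /=; rewrite mem_filter => /andP[].
apply: hull_eq hy => p /=; rewrite mem_filter => /andP[/asboolP].
by rewrite {1}eF => -[].
Qed.

Lemma face_polytope P F : polytope P -> face P F -> polytope F.
Proof. by move=> [s ->] /face_hull eF; eexists; exact: eF. Qed.

(** Off [G] the functional of [G], scaled by a large [M], dominates; on [G] it is constant and the
    functional of [F] decides. *)
Lemma face_trans P F G : polytope P -> face P G -> face G F -> face P F.
Proof.
move=> [s ->] [a [b [leb eG]]] [a' [b' [leb' eF]]].
have les p : p \in s -> dot a p <= b by move=> ps; apply: leb; exact: sub_hull.
have [M HM] := large_multiplier s (fun p => b - dot a p) (fun p => dot a' p - b').
pose h := M *: a + a'; pose B := M * b + b'.
have hE p : dot h p = M * dot a p + dot a' p by rewrite dotDl dotZl.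
have inG p : p \in s -> dot a p = b -> G p.
  by move=> ps ap; rewrite eG; split=> //; exact: sub_hull.
have lt_h p : p \in s -> dot a p <> b -> dot h p < B.
  move=> ps /eqP ap; have := HM p ps.
  by rewrite subr_gt0 lt_neqAle ap les // hE /B => /(_ isT); lra.
have leh p : p \in s -> dot h p <= B.
  move=> ps; have [ap|/(lt_h p ps)/ltW//] := pselect (dot a p = b).
  by rewrite hE /B ap lerD2l; apply: leb'; exact: inG.
exists h, B; split=> [x|]; first exact: hull_le.
rewrite eF eG; apply/seteqP; split=> x.
  by move=> [[Px /= ax] a'x]; split=> //=; rewrite hE ax a'x.
move=> [Px /= hx]; have ax : dot a x = b.
  have := hull_support leh Px hx; apply: hull_eq => p [/= ps hp].
  apply: contrapT => /(lt_h p ps); rewrite hp; lra.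
by split=> //=; move: hx; rewrite hE ax /B => /addrI.
Qed.

Lemma face_of_sub P F G : G `<=` P -> F `<=` G -> face P F -> face G F.
Proof.
move=> GP FG [a [b [leb eF]]]; exists a, b; split=> [x /GP/leb //|].
apply/seteqP; split=> x => [Fx|[/GP Px ax]]; last by rewrite eF.
by split; [exact: FG|move: Fx; rewrite eF => -[]].
Qed.

Lemma vertex_in P x : vertices P x -> P x.
Proof. by move/face_sub; apply. Qed.

Lemma vertex_mem s x : vertices (convex_hull [set` s]) x -> x \in s.
Proof.
move=> /face_hull e; have : [set x] x by [].
rewrite e => -[[|k] [w [p [ps _ w1 _]]]].
  by move: w1; rewrite big_ord0 => /esym/eqP; rewrite oner_eq0.
by have := ps ord0; rewrite /= mem_filter => /andP[/asboolP <-].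
Qed.

Lemma vertex_face P F x : polytope P -> face P F -> vertices F x -> vertices P x.
Proof. exact: face_trans. Qed.

Lemma vertex_restrict P F x : face P F -> F x -> vertices P x -> vertices F x.
Proof.
move=> /face_sub FP Fx; apply: face_of_sub => // _ ->; exact: Fx.
Qed.

(** [exposed_argmax] gives a maximizing generator that is also the unique maximizer of some [g],
    hence a vertex. *)
Lemma vertex_argmax P c x : polytope P -> P x ->
  exists2 y, vertices P y & forall z, P z -> dot c z <= dot c y.
Proof.
move=> [s ->] [[|k] [w [p [ps _ w1 _]]]].
  by move: w1; rewrite big_ord0 => /esym/eqP; rewrite oner_eq0.
have [q qs [qM [g gq]]] := exposed_argmax c (ps ord0).
exists q; last by move=> z; exact: hull_le.
have leg r : r \in s -> dot g r <= dot g q.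
  by move=> rs; have [->//|/(gq r rs)/ltW] := eqVneq r q.
exists g, (dot g q); split=> [z|]; first exact: hull_le.
apply/seteqP; split=> z; first by move=> ->; split=> //; exact: sub_hull.
move=> [Pz gz]; apply: hull_set1; have := hull_support leg Pz gz.
apply: hull_sub => r [/= rs gr]; apply: contrapT => /eqP/(gq r rs); rewrite gr; lra.
Qed.

(* A face F on which c is constant and not maximal is contained in a larger
   face, spanned by F and one extra direction r along which c increases. It is
   read off an exposed point, maximal for c, of the vertex figure of F in the
   quotient by U. *)
Lemma face_step P F U c x y : polytope P -> face P F -> F x ->
  (forall z, F z -> z - x \in U) -> (forall w, w \in U -> dot c w = 0) ->
  P y -> dot c x < dot c y ->
  exists G r, [/\ face P G, F `<=` G, exists2 z, G z & ~ F z, 0 < dot c r &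
    forall z, G z -> exists2 t, z - x - t *: r \in U & 0 <= t /\ (~ F z -> 0 < t)].
Proof.
move=> [s ->] [a [b [leb eF]]] Fx FU cU Py cxy.
have les p : p \in s -> dot a p <= b by move=> ps; apply: leb; exact: sub_hull.
(* A projection with kernel [U], standing for the quotient by [U]. *)
pose pr := (\1 - projv U)%VF.
have prE w : pr w = w - projv U w by rewrite add_lfunE id_lfunE opp_lfunE.
have prU w : w \in U -> pr w = 0 by move=> wU; rewrite prE projv_id ?subrr.
have cpr w : dot c (pr w) = dot c w.
  by rewrite prE dotBr (cU (projv U w)) ?subr0 // memv_proj.
pose lam p := b - dot a p.
have Flam z : convex_hull [set` s] z -> F z <-> lam z = 0.
  move=> Pz; rewrite eF /lam; split=> [[_ /= ->]|/eqP]; first by rewrite subrr.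
  by rewrite subr_eq0 => /eqP/esym.
have lam_ge0 p : p \in s -> 0 <= lam p by move/les; rewrite subr_ge0.
(* The slack [lam] vanishes on [P] exactly at the points of [F]; dividing by it places the
   generators outside [F] on the vertex figure. *)
pose q p := (lam p)^-1 *: pr (p - x).
pose S := [seq p <- s | 0 < lam p].
have [p1 p1s cp1] : exists2 p, p \in s & dot c x < dot c p.
  apply: contrapT => n; move: cxy; rewrite ltNge => /negP; apply.
  by apply: hull_le Py => p ps; rewrite leNgt; apply/negP => h; apply: n; exists p.
have p1S : p1 \in S.
  rewrite mem_filter p1s andbT lt_neqAle lam_ge0 // andbT.
  apply/negP => /eqP/esym/Flam => /(_ (sub_hull p1s))/FU/cU.
  rewrite dotBr; lra.
have [_ /mapP[p0 p0S ->] [cM [g gM]]] := exposed_argmax c (map_f q p1S).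
have p0s : p0 \in s by move: p0S; rewrite mem_filter => /andP[].
have l0 : 0 < lam p0 by move: p0S; rewrite mem_filter => /andP[].
have [g' g'E] := dot_adjoint pr g.
set mu := dot g (q p0) in gM.
(* At a generator [p] outside [F], [dot h p - B] is [lam p * (dot g (q p) - mu)]: never positive,
   and zero only if [q p = q p0]. *)
pose h := g' + mu *: a; pose B := dot g' x + mu * b.
have hB p : dot h p - B = dot g (pr (p - x)) - mu * lam p.
  by rewrite -g'E dotBr /h /B /lam dotDl dotZl; ring.
have lam0 p : p \in s -> ~~ (0 < lam p) -> lam p = 0 /\ pr (p - x) = 0.
  move=> ps nl; have e : lam p = 0.
    by apply/eqP; rewrite eq_le lam_ge0 // andbT leNgt.
  by split=> //; apply/prU/FU/Flam => //; exact: sub_hull.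
have prq p : 0 < lam p -> pr (p - x) = lam p *: q p.
  by move=> lp; rewrite /q scalerA divff ?gt_eqF // scale1r.
have qS p : p \in s -> 0 < lam p -> q p \in map q S.
  by move=> ps lp; apply: map_f; rewrite mem_filter lp.
have hle p : p \in s -> dot h p <= B.
  move=> ps; rewrite -subr_le0 hB; case: (boolP (0 < lam p)) => lp; last first.
    by have [-> ->] := lam0 p ps lp; rewrite dot0r mulr0 subrr.
  rewrite prq // dotZr subr_le0 mulrC ler_wpM2r ?(ltW lp) //.
  by have [->|/(gM _ (qS p ps lp))/ltW] := eqVneq (q p) (q p0); first exact: lexx.
have heq p : p \in s -> dot h p = B -> pr (p - x) = lam p *: q p0.
  move=> ps /eqP; rewrite -subr_eq0 hB.
  case: (boolP (0 < lam p)) => lp; last first.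
    by have [-> ->] := lam0 p ps lp; rewrite scale0r.
  rewrite prq // dotZr [mu * _]mulrC -mulrBr mulf_eq0 gt_eqF //= subr_eq0 => /eqP e.
  by congr (_ *: _); apply/eqP; apply: contraT => /(gM _ (qS p ps lp)); rewrite e ltxx.
have cq0 : 0 < dot c (q p0).
  have lp1 : 0 < lam p1 by move: p1S; rewrite mem_filter => /andP[].
  apply: lt_le_trans (cM _ (map_f q p1S)).
  by rewrite dotZr cpr dotBr mulr_gt0 ?invr_gt0 // subr_gt0.
exists (convex_hull [set` s] `&` [set z | dot h z = B]), (q p0); split=> //.
- by exists h, B; split=> [z|//]; exact: hull_le.
- move=> z Fz; have Pz : convex_hull [set` s] z by move: Fz; rewrite eF => -[].
  split=> //=; apply/eqP; rewrite -subr_eq0 hB (Flam z Pz).1 // prU ?FU //.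
  by rewrite dot0r mulr0 subrr.
- exists p0; last by move/(Flam _ (sub_hull p0s)); move: l0 => /[swap] ->; rewrite ltxx.
  split=> /=; first exact: sub_hull.
  by apply/eqP; rewrite -subr_eq0 hB prq // dotZr -/mu mulrC subrr.
(* The coefficient of [r] is the slack of [z], hence positive off [F]. *)
move=> z [Pz hz]; exists (lam z); last first.
  have lz : 0 <= lam z by rewrite subr_ge0; exact: leb.
  by split=> // nF; rewrite lt_neqAle lz andbT; apply/eqP => /esym/(Flam z Pz).
have : pr (z - x) = lam z *: q p0.
  have [k [w [p [hp _ w1 ->]]]] := hull_support hle Pz hz.
  have -> : \sum_i w i *: p i - x = \sum_i w i *: (p i - x).
    by under [RHS]eq_bigr do rewrite scalerBr; rewrite sumrB -scaler_suml w1 scale1r.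
  rewrite /lam dot_sumr -[b]mul1r -w1 mulr_suml -sumrB scaler_suml linear_sum.
  apply: eq_bigr => i _; rewrite linearZ -mulrBr -scalerA; congr (_ *: _).
  by have [] := hp i; exact: heq.
move=> e; rewrite -e prE opprB addrC subrK; exact: memv_proj.
Qed.

(** * Affine hulls and dimension *)

Lemma affine_hull_sub A x U : (forall p, A p -> p - x \in U) ->
  forall y, affine_hull A y -> y - x \in U.
Proof.
move=> AU _ [k [w [p [Ap w1 ->]]]].
rewrite -{1}(scale1r x) -w1 scaler_suml -sumrB.
by apply: memv_suml => i _; rewrite -scalerBr memvZ // AU.
Qed.

Lemma sub_affine_hull A : A `<=` affine_hull A.
Proof. by move=> x Ax; exists 1, (fun=> 1), (fun=> x); split; rewrite ?big_ord1 ?scale1r. Qed.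

Lemma has_dim_vspace A k : has_dim A k ->
  exists2 U, \dim U = k & forall y z, A y -> A z -> y - z \in U.
Proof.
move=> [x [U [dU eA]]]; exists U => // y z /sub_affine_hull + /sub_affine_hull.
by rewrite eA /= => yU zU; rewrite -(subrKA x) -[x - z]opprB rpredB.
Qed.

Lemma has_dim_le A k x U : has_dim A k -> (forall z, A z -> z - x \in U) ->
  (k <= \dim U)%N.
Proof.
move=> [x0 [V [<- eA]]] AU; apply: dimvS; apply/subvP => w wV.
have hA := affine_hull_sub AU.
have : x0 - x \in U by apply: hA; rewrite eA /= subrr mem0v.
have : (w + x0) - x \in U by apply: hA; rewrite eA /= addrK.
by move=> h1 h2; have := rpredB h1 h2; rewrite opprB addrA subrK addrK.
Qed.

Lemma has_dim1_ray A x r z : A x -> A z -> z <> x ->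
  (forall y, A y -> exists t, y - x = t *: r) -> has_dim A 1.
Proof.
move=> Ax Az zx Ar; have [t0 zr] := Ar z Az.
have : t0 *: r != 0 by rewrite -zr subr_eq0; apply/eqP.
rewrite scaler_eq0 negb_or => /andP[t00 r0].
exists x, <[r]>%VS; split; first by rewrite dim_vline r0.
apply/seteqP; split=> y.
  by apply: affine_hull_sub => p /Ar[t ->]; rewrite memvZ // memv_line.
move=> /vlineP[t /eqP]; rewrite subr_eq => /eqP ->.
(* The weights come from [y = x + t *: r] and [z = x + t0 *: r]. *)
exists 2%N, (fun i => if i == 0 then 1 - t / t0 else t / t0),
  (fun i => if i == 0 then x else z); split=> [i||]; first by case: ifP.
  by rewrite !big_ord_recl big_ord0 /= addr0 subrK.
rewrite !big_ord_recl big_ord0 /= addr0 scalerBl scale1r -addrA [- _ + _]addrC -scalerBr.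
by rewrite zr scalerA divfK // addrC.
Qed.

(** * Supporting functionals and edges *)

Lemma face_functional P F x : face P F -> F x -> exists h,
  [/\ forall z, F z -> dot h z = dot h x, forall z, P z -> dot h z <= dot h x
    & forall z, P z -> ~ F z -> dot h z < dot h x].
Proof.
move=> [h [b [leb ->]]] [Px /= hx]; exists h; rewrite hx; split=> //.
  by move=> z [].
move=> z Pz nF; rewrite lt_neqAle leb // andbT; apply/eqP => e; exact: nF.
Qed.

(** The optimality criterion of the simplex method. For the face [[set x]] and the zero space,
    [face_step] yields a face on a ray from [x], that is, an edge along which [c] increases. *)
Lemma improving_edge P x c y : polytope P -> vertices P x -> P y ->
  dot c x < dot c y -> exists2 z, adjacent P x z & dot c x < dot c z.
Proof.
move=> hP vx Py cxy.
have [|||||G [r [fG xG [z0 Gz0 nz0] cr GU]]] :=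
    @face_step P [set x] 0%VS c x y hP vx => //.
- by move=> z ->; rewrite subrr mem0v.
- by move=> w; rewrite memv0 => /eqP ->; rewrite dot0r.
have cG z : G z -> z <> x -> dot c x < dot c z.
  move=> /GU[t]; rewrite memv0 subr_eq0 => /eqP e [_ t0] /t0{}t0.
  by rewrite -subr_gt0 -dotBr e dotZr mulr_gt0.
have [z vz zM] := vertex_argmax c (face_polytope hP fG) Gz0.
have cz : dot c x < dot c z by apply: lt_le_trans (zM _ Gz0); exact: cG.
exists z => //; apply/asboolP; split=> //; first exact: vertex_face vz.
  by move=> e; move: cz; rewrite e ltxx.
exists G; split; [split=> //|exact: xG|exact: vertex_in].
apply: (@has_dim1_ray G x r z0) => // [|w /GU[t]]; first exact: xG.
by rewrite memv0 subr_eq0 => /eqP ? _; exists t.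
Qed.

Lemma adjacent_face P F x y : polytope P -> face P F ->
  adjacent F x y -> adjacent P x y.
Proof.
move=> hP fF /asboolP[vx vy xy [e [[fe de] ex ey]]]; apply/asboolP.
split=> //; try exact: vertex_face fF _.
by exists e; split=> //; split=> //; exact: face_trans fe.
Qed.

(** A vertex on an edge is an end of it: a functional maximal only at [x] decreases towards both [y]
    and [z], so [t] is positive. *)
Lemma edge_ray P (e : set _) x y z : edge P e -> vertices P x -> e x -> e y -> e z ->
  y <> x -> z <> x -> exists2 t, 0 < t & z - x = t *: (y - x).
Proof.
move=> [fe /has_dim_vspace[U dU eU]] vx ex ey ez yx zx.
have yx0 : y - x != 0 by rewrite subr_eq0; apply/eqP.
have eUy : U = <[y - x]>%VS.
  apply/esym/eqP; rewrite eqEdim dU dim_vline yx0 andbT -memvE; exact: eU.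
have : z - x \in U by exact: eU.
rewrite eUy => /vlineP[t et]; exists t => //.
have [h [_ _ hlt]] := face_functional vx (erefl x).
have := hlt y (face_sub fe ey) yx; have := hlt z (face_sub fe ez) zx.
rewrite -subr_lt0 -[dot h y < _]subr_lt0 -!dotBr et dotZr => h1 h2.
by rewrite -(nmulr_llt0 _ h2).
Qed.

(** At most two edges of a 2-face meet at a vertex. Each of [h1], [h2], [h3] vanishes on its own
    difference [y1 - x], [y2 - x], [y3 - x] and is negative on the other two, which makes the three
    differences independent. *)
Lemma no_three_edges P G x F1 F2 F3 y1 y2 y3 : has_dim G 2 -> G `<=` P -> G x ->
  face P F1 -> F1 x -> face P F2 -> F2 x -> face P F3 -> F3 x ->
  G y1 -> F1 y1 -> ~ F2 y1 -> ~ F3 y1 ->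
  G y2 -> ~ F1 y2 -> F2 y2 -> ~ F3 y2 ->
  G y3 -> ~ F1 y3 -> ~ F2 y3 -> F3 y3 -> False.
Proof.
move=> /has_dim_vspace[U dU GU] GP Gx.
move=> /face_functional /[apply] -[h1 [e1 _ l1]].
move=> /face_functional /[apply] -[h2 [e2 _ l2]].
move=> /face_functional /[apply] -[h3 [e3 _ l3]].
move=> Gy1 /e1/eqP e11 /(l2 y1 (GP _ Gy1)) l21 /(l3 y1 (GP _ Gy1)) l31.
move=> Gy2 /(l1 y2 (GP _ Gy2)) l12 /e2/eqP e22 /(l3 y2 (GP _ Gy2)) l32.
move=> Gy3 /(l1 y3 (GP _ Gy3)) l13 /(l2 y3 (GP _ Gy3)) l23 /e3/eqP e33.
move: e11 e22 e33 l12 l13 l21 l23 l31 l32.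
rewrite -subr_eq0 -dotBr => /eqP d1; rewrite -subr_eq0 -dotBr => /eqP d2.
rewrite -subr_eq0 -dotBr => /eqP d3; do 6!rewrite -subr_lt0 -dotBr => ?.
pose X := [tuple y1 - x; y2 - x; y3 - x].
have opp p q (s t : R) : p < 0 -> q < 0 -> s * p + t * q = 0 ->
    [/\ 0 < s -> t < 0, s < 0 -> 0 < t & s = 0 -> t = 0].
  by move=> p0 q0 e; split=> s0; nra.
have fX : free X.
  apply/freeP => k; rewrite !big_ord_recl big_ord0 /= addr0 => e.
  have hk h : k ord0 * dot h (y1 - x) + k (lift ord0 ord0) * dot h (y2 - x) +
      k (lift ord0 (lift ord0 ord0)) * dot h (y3 - x) = 0.
    by rewrite -!dotZr -!dotDr -addrA e dot0r.
  set a := k ord0 in hk; set b := k (lift _ _) in hk; set c := k _ in hk.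
  have [p1 n1 z1] : [/\ 0 < b -> c < 0, b < 0 -> 0 < c & b = 0 -> c = 0].
    by apply: (opp (dot h1 (y2 - x)) (dot h1 (y3 - x))) => //; have := hk h1; rewrite d1; lra.
  have [p2 n2 z2] : [/\ 0 < c -> a < 0, c < 0 -> 0 < a & c = 0 -> a = 0].
    by apply: (opp (dot h2 (y3 - x)) (dot h2 (y1 - x))) => //; have := hk h2; rewrite d2; lra.
  have [p3 n3 z3] : [/\ 0 < a -> b < 0, a < 0 -> 0 < b & a = 0 -> b = 0].
    by apply: (opp (dot h3 (y1 - x)) (dot h3 (y2 - x))) => //; have := hk h3; rewrite d3; lra.
  (* Any two of [a], [b], [c] have opposite signs, which is impossible for three nonzero numbers. *)
  have b0 : b = 0.
    by have [lt|lt|//] := ltgtP b 0; [have := n3 (p2 (n1 lt))|have := p3 (n2 (p1 lt))]; lra.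
  have c0 := z1 b0; have a0 := z2 c0.
  case=> -[|[|[|//]]] ilt; [rewrite -[RHS]a0|rewrite -[RHS]b0|rewrite -[RHS]c0];
    by congr k; apply: val_inj.
have : (\dim <<X>> <= \dim U)%N.
  apply/dimvS/span_subvP => w; rewrite !inE => /or3P[]/eqP ->; exact: GU.
by rewrite dU; move: fX; rewrite /free => /eqP ->.
Qed.

Lemma direction_space F x : polytope F -> F x -> exists U,
  [/\ forall z, F z -> z - x \in U,
      forall V : {vspace 'rV[R]_m}, (forall z, F z -> z - x \in V) -> (U <= V)%VS
    & forall c, (forall z, F z -> dot c z = dot c x) ->
      forall w, w \in U -> dot c w = 0].
Proof.
move=> [s eF] Fx; have sF p : p \in s -> F p by move=> ps; rewrite eF; exact: sub_hull.
pose X := in_tuple [seq p - x | p <- s]; exists <<X>>%VS; split=> [z|V FV|c cF w /coord_span ->].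
- rewrite eF => -[k [w [p [ps w0 w1 ->]]]]; apply: (@affine_hull_sub [set` s]).
    by move=> q qs; apply: memv_span; apply: (map_f _ qs).
  by exists k, w, p.
- by apply/span_subvP => _ /mapP[p ps ->]; apply/FV/sF.
rewrite dot_sumr big1 // => i _; have : X`_i \in X by rewrite mem_nth // size_tuple.
by move=> /mapP[p ps ->]; rewrite dotBr cF ?subrr ?mulr0 //; exact: sF.
Qed.

Lemma ltn_count (T : eqType) (p q : pred T) (s : seq T) : subpred p q ->
  (exists2 t, t \in s & q t && ~~ p t) -> (count p s < count q s)%N.
Proof.
move=> pq; elim: s => [[]//|z s IH] [t]; rewrite inE /= => /predU1P[->|ts] qpt.
  by case/andP: qpt => -> /negPf ->; rewrite add0n add1n ltnS sub_count.
rewrite -addnS leq_add //; last by apply: IH; exists t.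
by case: (p z) (pq z) => // ->.
Qed.

(** Amounts to every face being an intersection of facets. The induction enlarges [F] while keeping
    [y] outside, so fewer generators remain outside the face. *)
Lemma facet_avoid P F x y : polytope P -> face P F -> F x -> P y -> ~ F y ->
  exists H, [/\ facets P H, F `<=` H & ~ H y].
Proof.
move=> hP; have [s eP] := hP; pose outs F p := ~~ `[< F p >].
have lt_out F' G : face P F' -> face P G -> F' `<=` G -> G <> F' ->
    (count (outs G) s < count (outs F') s)%N.
  move=> fF fG FG GF; apply: ltn_count.
    by move=> p; apply: contra => /asboolP/FG/asboolP.
  apply: contrapT => n; apply: GF; apply/seteqP; split=> // z.
  move: fF fG; rewrite eP => /face_hull eF /face_hull {1}-> ; rewrite eF.
  apply: hull_sub => p; rewrite /= !mem_filter => /andP[Gp ps].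
  rewrite ps andbT; apply: contraT => nF; exfalso; apply: n; exists p => //.
  by rewrite /outs nF negbK.
have [k] := ubnP (count (outs F) s); elim: k F => // k IH F; rewrite ltnS => le fF Fx Py nFy.
have rec G : face P G -> F `<=` G -> G <> F -> ~ G y ->
    exists H, [/\ facets P H, F `<=` H & ~ H y].
  move=> fG FG GF nGy; have lt := leq_trans (lt_out _ _ fF fG FG GF) le.
  have [H [fH GH nH]] := IH G lt fG (FG _ Fx) Py nGy.
  by exists H; split=> // z /FG/GH.
have [fc|nfc] := pselect (facets P F); first by exists F; split=> // z.
have [K [fK KP FK KF]] : exists K, [/\ face P K, K <> P, F `<=` K & K <> F].
  apply: contrapT => n; apply: nfc; split=> // [e|K fK KP FK].
    by apply: nFy; rewrite e.
  by apply: contrapT => KF; apply: n; exists K.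
have [Ky|] := pselect (K y); last exact: rec.
have [z Pz nKz] : exists2 z, P z & ~ K z.
  apply: contrapT => n; apply: KP; apply/seteqP; split; first exact: face_sub.
  by move=> z Pz; apply: contrapT => nKz; apply: n; exists z.
(* As [K] contains [y], [F] is extended away from [K] instead: [- h] is constant on [K] and
   increases along [r], so points of [G] off [F] lie outside [K], and [G] misses [y]. *)
have [h [hK _ hlt]] := face_functional fK (FK _ Fx).
have [U [FU _ cU]] := direction_space (face_polytope hP fF) Fx.
have [|||G [r [fG FG [w Gw nFw] hr GU]]] := @face_step P F U (- h) x z hP fF Fx FU => //.
- by apply: cU => w /FK/hK; rewrite !dotNl => ->.
- by rewrite !dotNl ltrN2 hlt.
apply: (rec G) => // [e|Gy]; first by apply: nFw; rewrite -e.
have [t tU [_ /(_ nFy) t0]] := GU y Gy.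
have : dot (- h) (y - x - t *: r) = 0.
  by apply: cU tU => w' /FK/hK; rewrite !dotNl => ->.
rewrite dotBr dotZr dotBr !dotNl (hK y Ky).
move: (mulr_gt0 t0 hr); rewrite !dotNl; lra.
Qed.

(** Climbing from [F] to [P] by [face_step], each step adds at most one dimension and loses at least
    one facet, since some facet through [F] misses a point of the larger face. For a vertex and the
    zero space this gives [d] facets. *)
Lemma facet_count P F x d U (I : finType) (fac : I -> set 'rV[R]_m) :
  polytope P -> has_dim P d -> (forall H, facets P H -> exists i, fac i = H) ->
  face P F -> F x -> (forall z, F z -> z - x \in U) ->
  (d <= \dim U + #|[set i | `[< F `<=` fac i >]]%SET|)%N.
Proof.
move=> hP dP hfac.
have [k] := ubnP #|[set i | `[< F `<=` fac i >]]%SET|.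
elim: k F U => // k IH F U; rewrite ltnS => le fF Fx FU.
have [PF|/existsNP[y /not_implyP[Py nFy]]] := pselect (P `<=` F).
  exact: leq_trans (has_dim_le dP (fun z Pz => FU z (PF z Pz))) (leq_addr _ _).
have [h [hF _ hlt]] := face_functional fF Fx.
have [V [FV leV cV]] := direction_space (face_polytope hP fF) Fx.
have [|||G [r [fG FG [w Gw nFw] hr GV]]] := @face_step P F V (- h) x y hP fF Fx FV => //.
- by apply: cV => w /hF; rewrite !dotNl => ->.
- by rewrite !dotNl ltrN2 hlt.
have [H [fH FH nHw]] := facet_avoid hP fF Fx (face_sub fG Gw) nFw.
have lt : (#|[set i | `[< G `<=` fac i >]]%SET| < #|[set i | `[< F `<=` fac i >]]%SET|)%N.
  apply: proper_card; apply/properP; split.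
    by apply/fintype.subsetP => i; rewrite !finset.in_set => /asboolP Gi; apply/asboolP => z /FG/Gi.
  have [i ei] := hfac H fH; exists i; rewrite finset.in_set ei; first exact/asboolP.
  by apply/negP => /asboolP /(_ w Gw).
have GU z : G z -> z - x \in (V + <[r]>)%VS.
  move=> /GV[t tV _]; rewrite -(subrK (t *: r) (z - x)).
  by apply: memv_add => //; rewrite memvZ // memv_line.
have dU : (\dim (V + <[r]>) <= \dim U + 1)%N.
  apply: leq_trans (dimv_add_leqif _ _) _; rewrite leq_add ?dimvS ?leV //.
  by rewrite dim_vline leq_b1.
have := IH G (V + <[r]>)%VS (leq_trans lt le) fG (FG _ Fx) GU.
move=> /leq_trans; apply; apply: leq_trans (leq_add dU (leqnn _)) _.
by rewrite -addnA leq_add2l add1n.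
Qed.

(** * Cost-directed edges and monotone paths *)

Lemma adjacent_sym P x y : adjacent P x y -> adjacent P y x.
Proof.
move=> /asboolP[vx vy xy [e [ee ex ey]]]; apply/asboolP; split=> //.
  by move/esym.
by exists e.
Qed.

(** Provides the duality that exchanges the roles of [u] and [v]. *)
Lemma directed_edgeN P c x y : directed_edge P (- c) x y = directed_edge P c y x.
Proof.
rewrite /directed_edge !dotNl ltrN2; congr (_ && _).
by apply/idP/idP => /adjacent_sym.
Qed.

(** The simplex method: it terminates because the number of generators of larger cost drops at each
    step. *)
Lemma climb P c x : polytope P -> vertices P x -> exists p,
  [/\ path (directed_edge P c) x p, vertices P (last x p)
    & forall z, P z -> dot c z <= dot c (last x p)].
Proof.
move=> hP; have [s eP] := hP.
have [k] := ubnP (count (fun q => dot c x < dot c q) s).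
elim: k x => // k IH x; rewrite ltnS => le vx.
have [M|/existsNP[y /not_implyP[Py /negP]]] :=
  pselect (forall z, P z -> dot c z <= dot c x); first by exists [::].
rewrite -ltNge => /(improving_edge hP vx Py)[z xz cz].
have vz : vertices P z by have /asboolP[] := xz.
have lt : (count (fun q => dot c z < dot c q)%R s < count (fun q => dot c x < dot c q)%R s)%N.
  apply: ltn_count => [q|]; first exact: lt_trans.
  by exists z; [apply: vertex_mem; rewrite -eP|rewrite cz ltxx].
have [p [zp vp pM]] := IH z (leq_trans lt le) vz.
by exists (z :: p); split=> //=; rewrite zp /directed_edge xz cz.
Qed.

(** The order is an abstract relation [lt], so that the lemma also applies to [- c] with the order
    reversed. *)
Lemma no_edge_into_face P c u H (lt : 'rV[R]_m -> 'rV[R]_m -> Prop) :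
  polytope P -> simple_polytope P -> generic P c ->
  (forall x y z, lt x y -> lt y z -> lt x z) ->
  (forall x y, directed_edge P c x y -> lt x y /\ forall z, lt x z -> ~ lt z y) ->
  (forall z, P z -> dot c u <= dot c z) -> face P H -> H u ->
  forall a b, directed_edge P c a b -> H b -> H a.
Proof.
move=> hP hsimple hgen lt_tr hcov umin fH Hu a b; have [s eP] := hP.
(* Induction on the number of generators below [b]: edges into lower vertices are already known not
   to enter [H]. *)
have [k] := ubnP (count (fun q => dot c q < dot c b) s).
elim: k a b => // k IH b' b; rewrite ltnS => le b'b Hb; apply: contrapT => nHb'.
have /andP[/asboolP[vb' vb nb'b [e2 [ee2 e2b' e2b]]] cb'b] := b'b.
have IHlt z w : vertices P z -> dot c z < dot c b -> H z ->
    directed_edge P c w z -> H w.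
  move=> vz czb Hz wz; apply: (IH w z) => //; apply: leq_trans le.
  apply: ltn_count => [q /lt_trans|]; first exact.
  by exists z; [apply: vertex_mem; rewrite -eP|rewrite czb ltxx].
have pH := face_polytope hP fH.
(* [u] lies in [H] strictly below [b], so [b] does not minimize [c] on [H] and an edge of [H]
   descends from it. *)
have [a adH cab] : exists2 a, adjacent H b a & dot c a < dot c b.
  have [|a ad] := improving_edge (c := - c) pH (vertex_restrict fH Hb vb) Hu.
    by rewrite !dotNl ltrN2; apply: le_lt_trans cb'b; apply: umin; exact: vertex_in.
  by rewrite !dotNl ltrN2; exists a.
have /asboolP[_ va' nba [e1 [[fe1 de1] e1b e1a]]] := adH.
have Ha : H a by exact: vertex_in.
have va : vertices P a by exact: vertex_face va'.
have e1H := face_sub fe1.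
have ee1 : edge P e1 by split=> //; exact: face_trans fe1.
have ab : directed_edge P c a b.
  by rewrite /directed_edge cab andbT; exact/adjacent_sym/(adjacent_face hP fH).
have ne1b' : ~ e1 b' by move=> /e1H.
have [h [hH _ hlt]] := face_functional fH Hb.
(* Otherwise [a] and [b'] lie on one ray from [b], but [h] is equal at [a] and [b] and smaller at
   [b']. *)
have ne2a : ~ e2 a.
  move=> e2a; have [t _ et] := edge_ray ee2 vb e2b e2a e2b' (nesym nba) nb'b.
  have := hlt b' (vertex_in vb') nHb'; rewrite -subr_lt0 -dotBr et dotZr dotBr.
  by rewrite (hH a Ha) subrr mulr0 ltxx.
have [G [fG dG Gb EG]] : exists G, [/\ face P G, has_dim G 2, G b
    & forall e, [set e1; e2] e -> e `<=` G].
  apply: hsimple => // [|e [] ->//].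
  apply/card_set_bijP; exists (fun e => if `[< e = e1 >] then 0%N else 1%N).
  have ne : e2 <> e1 by move=> e; apply: ne2a; rewrite e.
  split=> [e _|e e' /set_mem[]-> /set_mem[]->|[|[|//]] _] /=; first by case: asboolP.
  - by [].
  - by rewrite asboolT // asboolF.
  - by rewrite asboolF // asboolT.
  - by [].
  - by exists e1; [left|rewrite asboolT].
  - by exists e2; [right|rewrite asboolF].
have Ga : G a by apply: (EG e1) => //; left.
have Gb' : G b' by apply: (EG e2) => //; right.
have pG := face_polytope hP fG.
(* An edge [e3] of [G] ascending from [b] would be a third edge there, distinct from the descending
   [e1] and [e2]. *)
have bmax z : G z -> dot c z <= dot c b.
  move=> Gz; rewrite leNgt; apply/negP.
  move=> /(improving_edge pG (vertex_restrict fG Gb vb) Gz)[y ady cby].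
  have /asboolP[_ vy nby [e3 [[fe3 de3] e3b e3y]]] := ady.
  have ee3 : edge P e3 by split=> //; exact: face_trans fe3.
  have opp e w : edge P e -> e b -> e w -> e y -> dot c w < dot c b -> False.
    move=> ee eb ew ey cwb.
    have nwb : w <> b by move=> e0; move: cwb; rewrite e0 ltxx.
    have [t t0 et] := edge_ray ee vb eb ew ey nwb (nesym nby).
    move: cby; rewrite -subr_gt0 -dotBr et dotZr pmulr_rgt0 // dotBr; lra.
  apply: (no_three_edges (P := P) (G := G) (x := b) (F1 := e1) (F2 := e2) (F3 := e3)
    (y1 := a) (y2 := b') (y3 := y)) => //; try exact: face_sub.
  - by case: ee1.
  - by case: ee2.
  - by case: ee3.
  - by move=> e3a; exact: opp e3a e3y cab.
  - by move=> e3b'; exact: opp e3b' e3y cb'b.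
  - exact: vertex_in.
  - by move=> e1y; exact: opp e1a e1y cab.
  - by move=> e2y; exact: opp e2b' e2y cb'b.
(* [h] is constant on [H], so an edge of [G] along which [h] drops leaves [H]. *)
have [|a1 ada1] := improving_edge (c := - h) pG (vertex_restrict fG Ga va) Gb'.
  by rewrite !dotNl ltrN2 (hH a Ha) hlt //; exact: vertex_in.
rewrite !dotNl ltrN2 (hH a Ha) => ha1.
have nHa1 : ~ H a1 by move=> /hH e; move: ha1; rewrite e ltxx.
(* The opposite orientation would give an edge entering [H] at [a], which is below [b]. *)
have aa1 : directed_edge P c a a1.
  have ad := adjacent_face hP fG ada1; have /asboolP[_ va1 na _] := ad.
  rewrite /directed_edge ad /=; have [//|ca|ca] := ltgtP (dot c a) (dot c a1).
    by exfalso; apply/nHa1/(IHlt a) => //; rewrite /directed_edge ca adjacent_sym.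
  by exfalso; apply: na; exact: hgen.
have va1 : vertices G a1 by have /asboolP[] := ada1.
(* A monotone path in [G] from [a1] ends at the maximum [b], placing [a1] strictly between [a] and
   [b]. *)
have [p [a1p vp pM]] := climb c pG va1.
have ep : last a1 p = b.
  apply: hgen => //; first exact: vertex_face vp.
  by apply/eqP; rewrite eq_le pM // bmax //; exact: vertex_in.
have : last a1 p = a1 \/ lt a1 (last a1 p).
  elim: p a1 {aa1 ada1 ha1 nHa1 va1 vp pM ep} a1p => [|z p IHp] x /=; first by left.
  move=> /andP[/andP[/(adjacent_face hP fG) xz cxz] /IHp[->|ltz]]; right.
    by apply: (hcov _ _ _).1; rewrite /directed_edge xz.
  by apply: lt_tr ltz; apply: (hcov _ _ _).1; rewrite /directed_edge xz.
rewrite ep => -[e|a1b]; first by apply: nHa1; rewrite -e.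
by apply: (hcov _ _ ab).2 a1b; exact: (hcov _ _ aa1).1.
Qed.

(** Counts the facets met by the path, by induction from its end: the last vertex meets at least
    [d], and each earlier vertex adds a new one. *)
Lemma directed_path_length P c d n (p : seq 'rV[R]_m) x : polytope P ->
  has_dim P d -> (facets P #= `I_n)%card -> face_nonrevisiting P c ->
  vertices P x -> path (directed_edge P c) x p -> (size p + d <= n)%N.
Proof.
move=> hP dP /card_esym/card_set_bijP[fac0 [_ _ surj]] nonrev.
pose fac (i : 'I_n) := fac0 i.
have hfac H : facets P H -> exists i, fac i = H.
  by move=> /surj[i /= lt_in <-]; exists (Ordinal lt_in).
pose hit x p := [set i | has (fun y => `[< fac i y >]) (x :: p)]%SET.
suff le : vertices P x -> path (directed_edge P c) x p -> (size p + d <= #|hit x p|)%N.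
  by move=> vx xp; apply: leq_trans (le vx xp) _; rewrite -[X in (_ <= X)%N]card_ord max_card.
elim: p x => [|y p IH] x vx /=.
  move=> _; have := facet_count (U := 0%VS) hP dP hfac vx (erefl x).
  have x0 z : [set x] z -> z - x \in 0%VS by move=> ->; rewrite subrr mem0v.
  move=> /(_ x0); rewrite dimv0 !add0n => /leq_trans; apply; apply: subset_leq_card.
  apply/fintype.subsetP => i; rewrite !finset.in_set /= orbF => /asboolP xi.
  by apply/asboolP; exact: xi.
move=> /andP[xy yp]; have /andP[/asboolP[_ vy nxy _] _] := xy.
(* [H] contains [x] but not [y]. If it met a later vertex [z], nonrevisiting on the path from [x] to
   [z] would put [y] in [H]. *)
have [H [fH xH nHy]] := facet_avoid hP vx erefl (vertex_in vy) (nesym nxy).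
have [i ei] := hfac H fH; rewrite addSn; apply: leq_ltn_trans (IH y vy yp) _.
apply: proper_card; apply/properP; split.
  by apply/fintype.subsetP => j; rewrite !finset.in_set /= => ->; rewrite orbT.
exists i; rewrite finset.in_set; first by rewrite /= ei asboolT //; exact: xH.
apply/hasPn => z yz; apply/negP => /asboolP; rewrite ei => Hz; apply: nHy.
case/splitPl: yz yp => p1 p2 ez; rewrite cat_path => /andP[yp1 _].
have [fcH _ _] := fH; apply: (nonrev H fcH x (y :: p1)) => //=.
- by rewrite xy.
- exact: xH.
- by rewrite ez.
- by rewrite !inE eqxx orbT.
Qed.

End ConvexGeometry.

(** * Nonrevisiting and the distance bound for spindles *)

Theorem theorem5p2 (R : realType) (m d n : nat) (P : set 'rV[R]_m)
    (u v c : 'rV[R]_m) (disp : Order.disp_t) (T : finTBPOrderType disp)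
    (f : T -> 'rV[R]_m)
    (hP : polytope P) (hdim : has_dim P d) (hsimple : simple_polytope P)
    (hfacets : (facets P #= `I_n)%card) (hspindle : spindle P u v)
    (hgeneric : generic P c)
    (hhasse : hasse_diagram (vertices P) (directed_edge P c) f)
    (hbot : f \bot%O = u) (htop : f \top%O = v) :
  [/\ face_nonrevisiting P c,
      forall p : seq 'rV[R]_m,
        path (directed_edge P c) u p -> last u p = v -> (size p + d <= n)%N
    & exists k : nat, graph_distance P u v k /\ (k + d <= n)%N].
Proof.
have [[_ finj fsurj] fcov] := hhasse.
have [vu vv facet_uv] := hspindle.
(* The strict order of [T], transported along [f]. *)
pose lt x y := exists s t : T, [/\ f s = x, f t = y & (s < t)%O].
have lt_tr x y z : lt x y -> lt y z -> lt x z.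
  move=> [s [t [<- ft st]]] [s' [t' [fs' <- st']]].
  have e : t = s' by apply: finj; rewrite ?in_setT // ft fs'.
  by exists s, t'; split=> //; apply: lt_trans st _; rewrite e.
have edge_f x y : directed_edge P c x y -> exists s t, [/\ f s = x, f t = y & covers t s].
  move=> xy; have /andP[/asboolP[/fsurj[s _ es] /fsurj[t _ et] _ _] _] := xy.
  by exists s, t; split=> //; apply/fcov; rewrite es et.
have hcov x y : directed_edge P c x y -> lt x y /\ forall z, lt x z -> ~ lt z y.
  move=> /edge_f[s [t [es et [st nst]]]]; split; first by exists s, t.
  move=> z [s1 [r [e1 er sr]]] [r' [t1 [er' e2 rt]]].
  have inj a b : f a = f b -> a = b by apply: finj; rewrite in_setT.
  have /negP := nst r; apply; apply/andP; split.
    by rewrite -(inj s1 s) // e1.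
  by rewrite (inj r r') ?er // -(inj t1 t) // e2.
(* Otherwise an improving edge for [- c] at [u] would be a directed edge ending at [u], and [\bot]
   would cover some element. *)
have umin z : P z -> dot c u <= dot c z.
  move=> Pz; rewrite leNgt; apply/negP => zu.
  have [|y uy] := improving_edge (c := - c) hP vu Pz; first by rewrite !dotNl ltrN2.
  rewrite !dotNl ltrN2 => yu.
  have /edge_f[s [t [_ et [st _]]]] : directed_edge P c y u.
    by rewrite /directed_edge adjacent_sym.
  have e : t = \bot%O by apply: finj; rewrite ?in_setT // et.
  by move: st; rewrite e ltx0.
have vmax z : P z -> dot c z <= dot c v.
  move=> Pz; rewrite leNgt; apply/negP => /(improving_edge hP vv Pz)[y vy cvy].
  have /edge_f[s [t [es _ [st _]]]] : directed_edge P c v y by rewrite /directed_edge vy.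
  have e : s = \top%O by apply: finj; rewrite ?in_setT // es.
  by move: st; rewrite e lt1x.
have u_face H : face P H -> H u -> forall a b, directed_edge P c a b -> H b -> H a.
  exact: no_edge_into_face hP hsimple hgeneric lt_tr hcov umin.
have v_face H : face P H -> H v -> forall a b, directed_edge P c a b -> H a -> H b.
  move=> fH Hv a b; rewrite -[directed_edge P c a b]directed_edgeN.
  (* The dual case: [v] is the minimum of [- c], and all edges and the order are reversed. *)
  apply: (no_edge_into_face (lt := fun x y => lt y x) hP hsimple _ _ _ _ fH Hv).
  - by move=> x y vx vy; rewrite !dotNl => /oppr_inj; exact: hgeneric.
  - by move=> x y z yx zy; exact: lt_tr zy yx.
  - move=> x y; rewrite directed_edgeN => /hcov[yx n_yx].
    by split=> // z zx yz; exact: n_yx yz zx.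
  - by move=> z Pz; rewrite !dotNl lerN2 vmax.
have nonrev : face_nonrevisiting P c.
  move=> F fF x p vx xp Fx Fl y yp; apply: contrapT => nFy.
  have vs : forall z, z \in x :: p -> vertices P z.
    elim: p x vx xp {Fx Fl yp} => [|w p IH] x vx /=.
      by move=> _ z; rewrite inE => /eqP ->.
    move=> /andP[/andP[/asboolP[_ vw _ _] _] wp] z; rewrite inE => /predU1P[->//|].
    exact: IH.
  have [H [fH FH nHy]] := facet_avoid hP fF Fx (vertex_in (vs y yp)) nFy.
  apply: nHy; have [fcH _ _] := fH; move/FH: Fx; move/FH: Fl.
  have [/u_face|/v_face] := facet_uv H fH => /(_ fcH) HE.
  (* If [u] is in [H], membership is pulled back along the path from its last vertex. *)
  - elim: p x xp yp {vx vs} => [|w p IH] x /=; first by move=> _; rewrite inE => /eqP ->.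
    move=> /andP[xw wp]; rewrite inE => /predU1P[-> //|yp] Hl Hx; apply: (IH w) => //.
    move: Hl {yp}; elim: p w {IH xw} wp => //= w' p IH w /andP[ww' w'p] Hl.
    by apply: HE ww' _; exact: IH.
  (* If [v] is in [H], membership is pushed forward from the first vertex. *)
  - move=> _; elim: p x xp yp {vx vs} => [|w p IH] x /=.
      by move=> _; rewrite inE => /eqP ->.
    move=> /andP[xw wp]; rewrite inE => /predU1P[-> //|yp] Hx; apply: (IH w) => //.
    exact: HE Hx.
split=> //.
  by move=> p up _; exact: directed_path_length hP hdim hfacets nonrev vu up.
(* A monotone path from [u] to the maximum [v] shows that the two are connected and bounds their
   distance. *)
have [p [up vl lmax]] := climb c hP vu.
have ep : last u p = v.
  apply: hgeneric => //; apply/eqP; rewrite eq_le vmax ?lmax //; exact: vertex_in.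
pose reach k := `[< exists p, [/\ path (adjacent P) u p, last u p = v & size p = k] >].
have reach_p : reach (size p).
  by apply/asboolP; exists p; split=> //; apply: sub_path up => x y /andP[].
have [k /asboolP kp kmin] := ex_minnP (ex_intro (fun k => reach k) _ reach_p).
exists k; split; last first.
  apply: leq_trans (directed_path_length hP hdim hfacets nonrev vu up).
  by rewrite leq_add2r kmin.
by split=> // q uq lq; apply: kmin; apply/asboolP; exists q.
Qed.
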